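(* Let $0<p_i<\infty$ and $\varphi_i\in\mathcal{G}_{p_i}(\mathbb{D})$ with $\varphi_i(1)=1$, $i=1,2$. Assume $\sup_{k\in\mathbb{N}_0}\varphi_i(2^k)=\infty$, $i=1,2$, and let $$\sup_{j\in\mathbb{N}_0}\frac{\varphi_2(2^j)}{\varphi_1(2^j)^{\varrho}}<\infty\qquad\text{with}\quad\varrho=\min\Big\{1,\frac{p_1}{p_2}\Big\}.$$ Consider the continuous embedding $\mathrm{id}: m_{\varphi_1,p_1}\hookrightarrow m_{\varphi_2,p_2}$. (i) Let $\lim_{\nu\to\infty}2^{-\nu d/p_2}\varphi_2(2^\nu)=0$. Then $\mathrm{id}$ is strictly singular if $\lim_{\nu\to\infty}2^{-\nu d/p_1}\varphi_1(2^\nu)=c$ for some $c>0$, with the additional assumption that $p_i\geq 1$ ($i=1,2$) in the case $p_1=p_2=\mathsf{r}_{\varphi_2}$. Conversely, if $\mathrm{id}$ is strictly singular, then $\lim_{\nu\to\infty}2^{-\nu d/p_1}\varphi_1(2^\nu)=c$ for some $c>0$, that is, $m_{\varphi_1,p_1}=\ell_{p_1}$ (with equivalent (quasi-)norms). (ii) Assume that $\lim_{\nu\to\infty}2^{-\nu d/p_2}\varphi_2(2^\nu)=c$ for some $c>0$, that is, $m_{\varphi_2,p_2}=\ell_{p_2}$ (with equivalent (quasi-)norms). Then $\mathrm{id}$ is strictly singular if, and only if, $\lim_{\nu\to\infty}2^{-\nu d/p_1}\varphi_1(2^\nu)=c'$ for some $c'>0$ and $p_1<p_2$.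
   Context: Let $d\geq 1$ be an integer and $\mathbb{N}_0=\{0,1,2,\dots\}$. Dyadic cubes: $Q_{j,k}=2^{-j}([0,1)^d+k)$ for $j\in\mathbb{Z}$, $k\in\mathbb{Z}^d$; in particular $Q_{-j,m}=2^j([0,1)^d+m)$. For a cube $Q$, $\ell(Q)$ is its side length and $|Q|=\ell(Q)^d$. Put $\mathbb{D}=\{2^j: j\in\mathbb{N}_0\}$. For $0<p<\infty$ and $\varphi:\mathbb{D}\to[0,\infty)$ not identically zero, $m_{\varphi,p}=m_{\varphi,p}(\mathbb{Z}^d)$ is the space of all complex sequences $\lambda=\{\lambda_k\}_{k\in\mathbb{Z}^d}$ with finite (quasi-)norm $$\|\lambda|m_{\varphi,p}\|=\sup_{j\in\mathbb{N}_0,\,m\in\mathbb{Z}^d}\frac{\varphi(\ell(Q_{-j,m}))}{|Q_{-j,m}|^{1/p}}\Big(\sum_{k:\,Q_{0,k}\subset Q_{-j,m}}|\lambda_k|^p\Big)^{1/p}.$$ $\mathcal{G}_p(\mathbb{D})$ is the set of all $\varphi:\mathbb{D}\to(0,\infty)$ with $1\leq\frac{\varphi(2^k)}{\varphi(2^j)}\leq 2^{(k-j)d/p}$ for all $j\leq k$, $j,k\in\mathbb{N}_0$. Consequently $\lim_{\nu\to\infty}2^{-\nu d/p}\varphi(2^\nu)$ exists for $\varphi\in\mathcal{G}_p(\mathbb{D})$. For $\varphi\in\bigcup_{p>0}\mathcal{G}_p(\mathbb{D})$ put $\mathsf{r}_\varphi=\sup\{p>0:\varphi\in\mathcal{G}_p(\mathbb{D})\}\in(0,\infty]$.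 $\ell_p=\ell_p(\mathbb{Z}^d)$ is the usual space of $p$-summable complex sequences indexed by $\mathbb{Z}^d$. A bounded linear operator $T:X\to Y$ between (quasi-)Banach spaces is called strictly singular if for each infinite-dimensional subspace $Z\subset X$, $\inf\{\|Tx|Y\|: x\in Z,\ \|x|X\|=1\}=0$. (For Banach spaces this is equivalent to: there is no infinite-dimensional closed subspace $Z$ of $X$ such that $T:Z\to T(Z)$ is an isomorphism.) *)

(* Defs.v *)
From HB Require Import structures.
From mathcomp Require Import all_boot all_order all_algebra.
From mathcomp Require Import complex.
From mathcomp Require Import all_classical all_reals all_analysis.

Set Implicit Arguments.
Unset Strict Implicit.
Unset Printing Implicit Defensive.

Import Order.TTheory GRing.Theory Num.Theory.
Import numFieldNormedType.Exports.

Local Open Scope classical_set_scope.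
Local Open Scope ring_scope.

Section StrictlySingular.
Context {R : realType}.

(* A (quasi-)normed space is given by an extended (quasi-)norm N on an ambient
   complex vector space U; the space itself is [carrier N], i.e. the vectors
   for which N is finite. *)
Definition carrier {U : lmodType R[i]} (N : U -> \bar R) : set U :=
  [set x | (N x < +oo)%E].

Definition subspace {U : lmodType R[i]} (X Z : set U) : Prop :=
  [/\ Z `<=` X, Z 0 &
      forall (a : R[i]) (u v : U), Z u -> Z v -> Z (a *: u + v)].

Definition finite_dimensional {U : lmodType R[i]} (Z : set U) : Prop :=
  exists (n : nat) (e : 'I_n -> U), (forall i, Z (e i)) /\
    (forall x, Z x -> exists a : 'I_n -> R[i], x = \sum_(i < n) a i *: e i).

(* The bound makes T map [carrier NX] into [carrier NY]. *)
Definition bounded_operator {U V : lmodType R[i]}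
    (NX : U -> \bar R) (NY : V -> \bar R) (T : {linear U -> V}) : Prop :=
  exists C : R, forall x, carrier NX x -> (NY (T x) <= C%:E * NX x)%E.

Definition strictly_singular {U V : lmodType R[i]}
    (NX : U -> \bar R) (NY : V -> \bar R) (T : {linear U -> V}) : Prop :=
  bounded_operator NX NY T /\
  forall Z : set U, subspace (carrier NX) Z -> ~ finite_dimensional Z ->
    ereal_inf [set NY (T x) | x in Z `&` [set x | NX x = 1%E]] = 0%E.

Definition same_space_equivalent_norms {U : lmodType R[i]}
    (N1 N2 : U -> \bar R) : Prop :=
  carrier N1 = carrier N2 /\
  exists a b : R, [/\ 0 < a, 0 < b & forall x, carrier N1 x ->
    (a%:E * N1 x <= N2 x)%E /\ (N2 x <= b%:E * N1 x)%E].

End StrictlySingular.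

Section MorreySequenceSpaces.
Context {R : realType}.

Local Notation zseq d := ('rV[int]_d -> R[i]).

Definition side (j : int) : R := 2 ^ (- j).

Definition volume (d : nat) (j : int) : R := side j ^+ d.

Definition cube (d : nat) (j : int) (k : 'rV[int]_d) : set 'rV[R]_d :=
  [set side j *: (y + map_mx intr k) | y in
    [set y : 'rV[R]_d | forall i, 0 <= y ord0 i < 1]].

(* Functions on D = {2^j : j >= 0} are represented by functions R -> R, of
   which only the values on D are ever used. *)
Definition m_norm (d : nat) (phi : R -> R) (p : R) (lam : zseq d) : \bar R :=
  ereal_sup [set
    ((phi (side (- jm.1%:Z)) / volume d (- jm.1%:Z) `^ p^-1)%:E *
     (\esum_(k in [set k | cube 0 k `<=` cube (- jm.1%:Z) jm.2])
        (Normc.normc (lam k) `^ p)%:E) `^ p^-1)%E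
    | jm in [set: nat * 'rV[int]_d]].

Definition lp_norm (d : nat) (p : R) (lam : zseq d) : \bar R :=
  ((\esum_(k in [set: 'rV[int]_d]) (Normc.normc (lam k) `^ p)%:E) `^ p^-1)%E.

Definition G_class (d : nat) (p : R) : set (R -> R) :=
  [set phi | (forall j : nat, 0 < phi (2 ^+ j)) /\
    forall j k : nat, (j <= k)%N ->
      1 <= phi (2 ^+ k) / phi (2 ^+ j) <= 2 `^ ((k - j)%:R * d%:R / p)].

Definition r_index (d : nat) (phi : R -> R) : \bar R :=
  ereal_sup [set p%:E | p in [set p : R | 0 < p /\ G_class d p phi]].

Definition unbounded_on_D (phi : R -> R) : Prop :=
  ereal_sup [set (phi (2 ^+ k))%:E | k in [set: nat]] = +oo%E.

Definition scaled (d : nat) (phi : R -> R) (p : R) : nat -> R :=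
  fun nu => 2 `^ (- (nu%:R * d%:R / p)) * phi (2 ^+ nu).

(* Every complex sequence is available in both spaces, so the embedding is
   the identity of the ambient space. *)
Definition embedding (d : nat) : {linear zseq d -> zseq d} := idfun.

End MorreySequenceSpaces.

Arguments embedding : clear implicits.

(* Main.v *)
Require Import Defs.
From HB Require Import structures.
From mathcomp Require Import all_boot all_order all_algebra.
From mathcomp Require Import complex.
From mathcomp Require Import all_classical all_reals all_analysis.
From mathcomp Require Import lra zify.

Set Implicit Arguments.
Unset Strict Implicit.
Unset Printing Implicit Defensive.

Import Order.TTheory GRing.Theory Num.Theory.
Import numFieldNormedType.Exports.

Local Open Scope classical_set_scope.
Local Open Scope ring_scope.

(** Why the theorem holds. Write [s_j] for the number [scaled d phi p j]; the
    Morrey norm is the supremum over all cubes [Q] of side [2 ^ j] of [s_j]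
    times the [l_p] norm of the restriction to [Q]. The sequence [s_j] starts at
    1 and decreases, to a limit [c >= 0].

    If [c > 0], the norm is equivalent to that of [l_p]: the upper bound is
    obvious, and for the lower one a finite set of lattice points is covered by
    [2 ^ d] large cubes, one in each orthant ([lp_le_m_norm]).

    If [c = 0], there is a sparse infinite set of lattice points on which
    bounded sequences have Morrey norm at most their supremum
    ([sparse_points]). Since every Morrey norm dominates the supremum, the two
    norms of the embedding are comparable on the finitely supported sequences on
    this set when [c = 0] for the source. A strictly singular embedding thus has
    a source equivalent to [l_p1] ([strictly_singular_source]).

    Let the source be [l_p1]. The tool is a gliding hump ([gliding_hump]): in
    an infinite-dimensional subspace one adds normalised vectors that are almost
    disjoint, so the mass of the sum grows; if a second norm is a supremum of
    levels, and each new vector is negligible on the levels where the previous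
    sum lives, the second norm of the sum stays bounded. The moduli of the
    coordinates as levels give normalised vectors with arbitrarily small entries
    ([flat_vector]). If the target has limit 0, the levels of its Morrey norm
    can be used next: level [j] is controlled by the supremum of the entries,
    and each fixed vector is small on late levels. This gives strict singularity
    in part (i) for all exponents at once ([strictly_singular_lp_source]). If
    the target is [l_p2] with [p1 < p2], the flat vectors themselves have small
    norm by interpolation. If [p2 <= p1], the norm of [l_p1] is dominated by
    that of [l_p2], so the embedding is not strictly singular. *)

Local Notation normc := Normc.normc.
(* The topology library reuses this name for subspace topologies. *)
Local Notation subspace := Defs.subspace.

(** * Real powers of moduli *)

Section Powers.
Context {R : realType}.
Implicit Types (a b p q : R) (u v : R[i]).

Lemma normc_ge0 u : 0 <= normc u.
Proof. by case: u => a b; exact: sqrtr_ge0. Qed.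

Lemma normcD_le u v : normc (u + v) <= normc u + normc v.
Proof. exact: (@le_normcD R u v). Qed.

Lemma normc_gt0 u : u != 0 -> 0 < normc u.
Proof.
by move=> u0; rewrite lt_def normc_ge0 andbT; apply: contra u0 => /eqP/Normc.eq0_normc->.
Qed.

Lemma ler_powR2 p a b : 0 <= p -> 0 <= a -> a <= b -> a `^ p <= b `^ p.
Proof.
move=> p0 a0 ab; apply: ge0_ler_powR => //; rewrite nnegrE //; exact: le_trans ab.
Qed.

Lemma ler_powR_inv p a b : 0 < p -> 0 <= b -> a `^ p <= b `^ p -> a <= b.
Proof.
move=> p0 b0; apply: contraTle => ba; rewrite -ltNge.
by apply: gt0_ltr_powR => //; rewrite nnegrE // (le_trans b0) // ltW.
Qed.

Lemma powRVK p a : 0 < p -> 0 <= a -> (a `^ p) `^ p^-1 = a.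
Proof. by move=> p0 a0; rewrite -powRrM mulfV ?gt_eqF // powRr1. Qed.

Lemma powRKV p a : 0 < p -> 0 <= a -> (a `^ p^-1) `^ p = a.
Proof. by move=> p0 a0; rewrite -powRrM mulVf ?gt_eqF // powRr1. Qed.

Lemma powR_div p a b : 0 <= a -> 0 <= b -> (a / b) `^ p = a `^ p / b `^ p.
Proof.
move=> a0 b0; rewrite powRM ?invr_ge0 //; congr (_ * _).
by rewrite -powR_inv1 // -powRrM mulN1r powRN.
Qed.

(** Valid for every exponent, in particular for those below 1 and above 1 at
    once: if [|v| <= t |u|] the first term dominates, otherwise the second. *)
Lemma normcD_powR_le p t u v : 0 <= p -> 0 < t ->
  normc (u + v) `^ p <=
    (1 + t) `^ p * normc u `^ p + (1 + t^-1) `^ p * normc v `^ p.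
Proof.
move=> p0 t0; have uv := normcD_le u v.
have t1 : 0 <= 1 + t by rewrite addr_ge0 // ltW.
have t2 : 0 <= 1 + t^-1 by rewrite addr_ge0 // invr_ge0 ltW.
have [le|lt] := leP (normc v) (t * normc u).
  apply: (@le_trans _ _ ((1 + t) `^ p * normc u `^ p)).
    rewrite -powRM ?normc_ge0 //; apply: ler_powR2; rewrite ?normc_ge0 //.
    by rewrite mulrDl mul1r (le_trans uv) // lerD2l.
  by rewrite lerDl mulr_ge0 // powR_ge0.
apply: (@le_trans _ _ ((1 + t^-1) `^ p * normc v `^ p)).
  rewrite -powRM ?normc_ge0 //; apply: ler_powR2; rewrite ?normc_ge0 //.
  rewrite mulrDl mul1r (le_trans uv) // addrC lerD2l.
  by rewrite mulrC ler_pdivlMr // mulrC ltW.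
by rewrite lerDr mulr_ge0 // powR_ge0.
Qed.

(** Removes the root and the weight from one term of a Morrey norm; an infinite
    sum [E] makes both sides false. *)
Lemma root_leP p (w M : R) (E : \bar R) : 0 < p -> 0 < w -> 0 <= M ->
  (0 <= E)%E ->
  (w%:E * E `^ p^-1 <= M%:E)%E <-> (E <= ((M / w) `^ p)%:E)%E.
Proof.
move=> p0 w0 M0; have pV : p^-1 != 0 by rewrite invr_eq0 gt_eqF.
case: E => [e||] // e0.
- rewrite lee_fin in e0; rewrite poweR_EFin -EFinM !lee_fin mulrC -ler_pdivlMr //.
  have Mw : 0 <= M / w by rewrite divr_ge0 // ltW.
  split=> [|h].
    move=> /(ler_powR2 (ltW p0) (powR_ge0 _ _)).
    by rewrite powRKV.
  apply: (@ler_powR_inv p) => //; by rewrite powRKV.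
- by rewrite poweRyr // gt0_muley ?lte_fin // !leye_eq.
Qed.

End Powers.

(** * Finite power sums *)

Section Mass.
Context {R : realType} {K : choiceType}.
Implicit Types (p q c : R) (x y : K -> R[i]) (s : seq K) (A B : set K).

Lemma funD_apply x y k : (x + y) k = x k + y k. Proof. by []. Qed.

Lemma funZ_apply (a : R[i]) x k : (a *: x) k = a * x k. Proof. by []. Qed.

Definition mass p x s : R := \sum_(k <- s) normc (x k) `^ p.

(** A bound for all finite partial sums over [A]. Infinite sums enter the
    estimates only in this form, so that these are about finite real sums. *)
Definition mass_le p A x c : Prop :=
  forall s, uniq s -> (forall k, k \in s -> A k) -> mass p x s <= c.

Lemma mass_ge0 p x s : 0 <= mass p x s.
Proof. by apply: sumr_ge0 => k _; exact: powR_ge0. Qed.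

Lemma mass_cat p x s (t : seq K) : mass p x (s ++ t) = mass p x s + mass p x t.
Proof. exact: big_cat. Qed.

Lemma mass_seq1 p x k : mass p x [:: k] = normc (x k) `^ p.
Proof. exact: big_seq1. Qed.

Lemma mass_filter p x s (P : pred K) : 0 < p ->
  (forall k, k \in s -> ~~ P k -> x k = 0) ->
  mass p x [seq k <- s | P k] = mass p x s.
Proof.
move=> p0 H; rewrite /mass big_filter [RHS](bigID P) /= [X in _ + X]big1_seq ?addr0 //.
by move=> k /andP[nP ks]; rewrite H // Normc.normc0 powR0 // gt_eqF.
Qed.

Lemma eq_mass p x y s : (forall k, k \in s -> x k = y k) -> mass p x s = mass p y s.
Proof. by move=> H; apply: eq_big_seq => k ks; rewrite H. Qed.

Lemma massZ p (a : R[i]) x s : mass p (a *: x) s = normc a `^ p * mass p x s.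
Proof.
rewrite /mass big_distrr /=; apply: eq_bigr => k _.
by rewrite -powRM ?normc_ge0 // -Normc.normcM.
Qed.

Lemma massD_le p t x y s : 0 <= p -> 0 < t ->
  mass p (x + y) s <= (1 + t) `^ p * mass p x s + (1 + t^-1) `^ p * mass p y s.
Proof.
move=> p0 t0; rewrite /mass !big_distrr -big_split /=; apply: ler_sum => k _.
exact: normcD_powR_le.
Qed.

Lemma mass_le_ge0 p A x c : mass_le p A x c -> 0 <= c.
Proof. by move=> /(_ [::] isT); rewrite /mass big_nil; apply. Qed.

Lemma mass_leW p A B x c d : A `<=` B -> c <= d -> mass_le p B x c -> mass_le p A x d.
Proof.
move=> AB cd H s us sA; apply: le_trans cd; apply: H => // k ks; exact/AB/sA.
Qed.

Lemma mass_le_coord p A x c k : 0 < p -> A k -> mass_le p A x c -> normc (x k) <= c `^ p^-1.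
Proof.
move=> p0 Ak /(_ [:: k] isT); rewrite mass_seq1 => H.
have {}H : normc (x k) `^ p <= c by apply: H => j; rewrite inE => /eqP->.
rewrite -[leLHS](@powRVK _ p) ?normc_ge0 //; apply: ler_powR2 H; rewrite ?powR_ge0 //.
by rewrite invr_ge0 ltW.
Qed.

Lemma mass_leZ p A (a : R[i]) x c : mass_le p A x c -> mass_le p A (a *: x) (normc a `^ p * c).
Proof. by move=> H s us sA; rewrite massZ ler_wpM2l ?powR_ge0 // H. Qed.

Lemma mass_leD p t A x y c d : 0 <= p -> 0 < t -> mass_le p A x c -> mass_le p A y d ->
  mass_le p A (x + y) ((1 + t) `^ p * c + (1 + t^-1) `^ p * d).
Proof.
move=> p0 t0 Hx Hy s us sA; apply: le_trans (massD_le _ _ _ p0 t0) _.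
by rewrite lerD // ler_wpM2l ?powR_ge0 // ?Hx ?Hy.
Qed.

Lemma mass_le_size p A x (l : seq K) M : 0 < p -> (forall k, normc (x k) <= M) ->
  (forall k, A k -> x k != 0 -> k \in l) -> mass_le p A x ((size l)%:R * M `^ p).
Proof.
move=> p0 xM H s us sA; rewrite -(@mass_filter _ _ _ (mem l)) //; last first.
  by move=> k ks; apply: contraNeq => /H; apply; exact: sA.
set s' := [seq k <- s | _].
have le : (size s' <= size l)%N.
  by apply: uniq_leq_size; rewrite ?filter_uniq // => k; rewrite mem_filter => /andP[].
apply: (@le_trans _ _ (\sum_(k <- s') M `^ p)).
  by apply: ler_sum => k _; apply: ler_powR2; rewrite ?normc_ge0 // ltW.
by rewrite big_const_seq count_predT iter_addr_0 -[leLHS]mulr_natl ler_wpM2r ?powR_ge0 // ler_nat.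
Qed.

(** Pointwise [r^q = r^(q-p) r^p], and [r <= M]. *)
Lemma mass_le_interp p q A x M c : 0 < p -> p <= q -> (forall k, A k -> normc (x k) <= M) ->
  mass_le p A x c -> mass_le q A x (M `^ (q - p) * c).
Proof.
move=> p0 pq xM H s us sA; apply: le_trans (ler_wpM2l (powR_ge0 _ _) (H s us sA)).
rewrite /mass big_distrr /= [leLHS]big_seq [leRHS]big_seq; apply: ler_sum => k ks.
have [x0|x0] := eqVneq (normc (x k)) 0.
  rewrite x0 !powR0 ?mulr0 // gt_eqF //; exact: lt_le_trans pq.
rewrite -[in leLHS](subrK p q) [leLHS]powRD ?x0 ?implybT //.
by rewrite ler_wpM2r ?powR_ge0 // ler_powR2 ?subr_ge0 ?normc_ge0 // xM //; exact: sA.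
Qed.

(** The inequality [r^q <= D^q + D^(q-p) r^p] replaces the power mean
    inequality, at the price of the factor 2. *)
Lemma mass_le_power_mean p q A x (l : seq K) D : 0 < q -> q <= p -> 0 < D ->
  (forall k, A k -> k \in l) ->
  mass_le p A x ((size l)%:R * D `^ p) ->
  mass_le q A x (2 * (size l)%:R * D `^ q).
Proof.
move=> q0 qp D0 Al H s us sA.
apply: (@le_trans _ _ (\sum_(k <- s) (D `^ q + D `^ (q - p) * normc (x k) `^ p))).
  apply: ler_sum => k _; have [le|lt] := leP (normc (x k)) D.
    apply: le_trans (_ : D `^ q <= _); first by rewrite ler_powR2 ?normc_ge0 // ltW.
    by rewrite lerDl mulr_ge0 ?powR_ge0.
  have x0 : 0 < normc (x k) by exact: lt_trans lt.
  apply: le_trans (_ : D `^ (q - p) * normc (x k) `^ p <= _); last by rewrite lerDr powR_ge0.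
  rewrite -[q in leLHS](subrK p q) [leLHS]powRD ?(gt_eqF x0) ?implybT //.
  rewrite ler_wpM2r ?powR_ge0 // -opprB !powRN lef_pV2 ?posrE ?powR_gt0 //.
  by rewrite ler_powR2 ?subr_ge0 // ltW.
rewrite big_split /= -big_distrr /= big_const_seq count_predT iter_addr_0.
rewrite -[X in X + _ <= _]mulr_natl.
have -> : 2 * (size l)%:R * D `^ q = (size l)%:R * D `^ q + (size l)%:R * D `^ q :> R.
  by rewrite -mulrA mulr_natl mulr2n.
apply: lerD; first by rewrite ler_wpM2r ?powR_ge0 // ler_nat uniq_leq_size // => k /sA/Al.
apply: le_trans (ler_wpM2l (powR_ge0 _ _) (H s us sA)) _.
rewrite mulrCA -powRD ?(gt_eqF D0) ?implybT //.
by rewrite subrK.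
Qed.

Lemma esum_massP p A x c :
  (\esum_(k in A) (normc (x k) `^ p)%:E <= c%:E)%E <-> mass_le p A x c.
Proof.
split=> [H s us sA|H].
  rewrite -lee_fin; apply: le_trans H; apply: esum_ge.
  exists [set` s]; first by split=> [|k]; [exact: finite_seq|exact: sA].
  by rewrite -fsbig_seq // sumEFin.
apply/ereal_supP => _ [F [finF FA] <-].
rewrite fsbig_finite //= sumEFin lee_fin; apply: H; first exact: finmap.fset_uniq.
by move=> k; rewrite in_fset_set // inE => /FA.
Qed.

Lemma mass_sup p x c : mass_le p setT x c ->
  exists2 m, mass_le p setT x m & forall e, 0 < e -> exists2 s, uniq s & m - e < mass p x s.
Proof.
move=> xc; pose S := [set m | exists2 s, uniq s & m = mass p x s].
have S0 : S !=set0 by exists (mass p x [::]), [::].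
have Sc : has_ubound S by exists c => _ [s us ->]; apply: xc.
exists (sup S) => [s us _|e e0]; first by apply: ub_le_sup => //; exists s.
by have [_ [s us ->] ?] := sup_adherent e0 (conj S0 Sc); exists s.
Qed.

(** Finite total mass leaves little mass outside a suitable finite set: any
    list that nearly exhausts the total will do. *)
Lemma mass_tail p x c e : mass_le p setT x c -> 0 < e ->
  exists F : seq K, mass_le p [set k | k \notin F] x e.
Proof.
move=> /mass_sup[m xm mP] e0; have [F uF hF] := mP e e0.
exists F => s us sF; have : mass p x (F ++ s) <= m.
  apply: xm => //; rewrite cat_uniq uF us andbT /=.
  by apply/hasPn => k /sF.
by rewrite mass_cat; lra.
Qed.

Lemma mass_subset p x s (t : seq K) : uniq s -> {subset s <= t} -> uniq t ->
  mass p x s <= mass p x t.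
Proof.
move=> us st ut; rewrite [leRHS]/mass (bigID (mem s)) /= -[leLHS]addr0 lerD ?sumr_ge0 //.
  rewrite le_eqVlt; apply/orP; left; apply/eqP.
  rewrite -big_filter; apply: perm_big; apply: uniq_perm; rewrite ?filter_uniq // => k.
  by rewrite mem_filter; case: (boolP (k \in s)) => //= /st ->.
by move=> k _; exact: powR_ge0.
Qed.

Lemma massN p x s : mass p (- x) s = mass p x s.
Proof. by apply: eq_bigr => k _; rewrite -[normc (- _)]/(normc (- x k)) (@normcN R (x k)). Qed.

End Mass.

(** * Dyadic cubes and the radius form of the Morrey norm *)

Section Blocks.
Context {R : realType} {d : nat}.
Local Notation K := 'rV[int]_d.
Implicit Types (p M : R) (phi : R -> R) (x : K -> R[i]) (j : nat) (m k : K).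

Definition block j m : set K :=
  [set k | forall i, (2 ^ j)%N%:Z * m ord0 i <= k ord0 i < (2 ^ j)%N%:Z * (m ord0 i + 1)].

Lemma side_negn j : side (- j%:Z) = 2 ^+ j :> R.
Proof. by rewrite /side opprK. Qed.

(** The inclusion is tested at the corner [k] of the small cube, and the
    resulting inequalities between integers suffice for all its points. *)
Lemma cube_subsetP j m k :
  (cube 0 k : set 'rV[R]_d) `<=` cube (- j%:Z) m <-> block j m k.
Proof.
have side0 : side 0 = 1 :> R by rewrite /side oppr0 expr0z.
have pow2 : 2 ^+ j = (2 ^ j)%N%:Z%:~R :> R by rewrite -pmulrn natrX.
have pow2_gt0 : 0 < 2 ^+ j :> R by rewrite exprn_gt0.
split=> [H i|H].
  have [|y y01] := H (map_mx intr k).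
    by exists 0 => [i0|]; rewrite ?mxE ?lexx ?ltr01 // side0 scale1r add0r.
  move=> /rowP/(_ i); rewrite !mxE side_negn pow2 => e.
  have /andP[y0 y1] := y01 i.
  rewrite -(ler_int R) -(ltr_int R) !rmorphM rmorphD /= -e -pow2.
  by rewrite ler_pM2l // ltr_pM2l // lerDr y0 addrC ltrD2l.
move=> _ [y y01 <-]; exists ((2 ^+ j)^-1 *: (y + map_mx intr k) - map_mx intr m); last first.
  by rewrite subrK side_negn scalerA mulfV ?gt_eqF // side0.
move=> i; rewrite !mxE; have /andP[y0 y1] := y01 i; have /andP[k0 k1] := H i.
rewrite subr_ge0 ltrBlDr mulrC ler_pdivlMr // ltr_pdivrMr // mulrC pow2.
rewrite [leRHS]addrC; apply/andP; split.
  by rewrite -rmorphM /= -[leLHS]addr0 lerD // ler_int.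
have k1' : k ord0 i + 1 <= (2 ^ j)%N%:Z * (m ord0 i + 1) by lia.
apply: (@lt_le_trans _ _ (1 + (k ord0 i)%:~R)); first by rewrite ltrD2r.
by rewrite addrC -[1]/(1%:~R) -rmorphD -rmorphD -rmorphM /= ler_int mulrC (addrC 1).
Qed.

Lemma block_seq j m : exists2 l : seq K,
  size l = (2 ^ (j * d))%N & forall k, block j m k -> k \in l.
Proof.
pose pt (f : {ffun 'I_d -> 'I_(2 ^ j)}) : K :=
  \row_i ((2 ^ j)%N%:Z * m ord0 i + (f i : nat)%:Z).
exists [seq pt f | f : {ffun 'I_d -> 'I_(2 ^ j)}].
  by rewrite size_map -cardE card_ffun !card_ord expnM.
move=> k kB; have lt i : (absz (k ord0 i - (2 ^ j)%N%:Z * m ord0 i)%R < 2 ^ j)%N.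
  by have := kB i; rewrite mulrDr mulr1; move: (_ * m ord0 i) => z; lia.
apply/mapP; exists [ffun i => Ordinal (lt i)]; first by rewrite mem_enum.
apply/rowP => i; rewrite mxE ffunE /=; have /andP[lo _] := kB i.
by rewrite gez0_abs ?subr_ge0 // addrC subrK.
Qed.

Lemma block0_self k : block 0 k k.
Proof. by move=> i; rewrite mul1r; lia. Qed.

Section Growth.
Context {phi : R -> R} {p : R}.
Hypothesis (p0 : 0 < p) (Gphi : G_class d p phi).

Lemma G_gt0 j : 0 < phi (2 ^+ j). Proof. exact: (Gphi.1). Qed.

Lemma scaled_gt0 j : 0 < scaled d phi p j.
Proof. by rewrite mulr_gt0 ?G_gt0 // powR_gt0. Qed.

Lemma G_nondecreasing j j' : (j <= j')%N -> phi (2 ^+ j) <= phi (2 ^+ j').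
Proof. by move=> /Gphi.2 /andP[+ _]; rewrite ler_pdivlMr ?G_gt0 // mul1r. Qed.

Lemma scaled_nonincreasing j j' : (j <= j')%N -> scaled d phi p j' <= scaled d phi p j.
Proof.
move=> jj'; have /andP[_] := Gphi.2 _ _ jj'; rewrite ler_pdivrMr ?G_gt0 // => H.
rewrite /scaled; apply: le_trans (ler_wpM2l (powR_ge0 _ _) H) _.
rewrite mulrA -powRD ?pnatr_eq0 ?implybT // ler_wpM2r ?(ltW (G_gt0 _)) //.
rewrite natrB // le_eqVlt; apply/orP; left; apply/eqP; congr (_ `^ _); lra.
Qed.

Lemma scaled_le1 j : phi 1 = 1 -> scaled d phi p j <= 1.
Proof.
move=> phi1; apply: le_trans (scaled_nonincreasing (leq0n j)) _.
by rewrite /scaled !mul0r oppr0 powRr0 mul1r expr0 phi1.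
Qed.

(** The right-hand side exhibits the number of lattice points in a cube, the
    left-hand side the monotone factor [scaled]; both forms of the radius are
    convenient. *)
Lemma scaled_div_powR j M : 0 <= M ->
  (M / scaled d phi p j) `^ p = (2 ^ (j * d))%N%:R * (M / phi (2 ^+ j)) `^ p.
Proof.
move=> M0; have M1 : 0 <= M / phi (2 ^+ j) by rewrite divr_ge0 // ltW // G_gt0.
rewrite /scaled powRN invfM invrK mulrCA [LHS]powRM ?powR_ge0 //.
by rewrite -powRrM divfK ?gt_eqF // -natrM powR_mulrn // natrX.
Qed.

(** The Morrey ball of radius [M], described by power sums over cubes:
    bounds for the Morrey norm are proved and used in this form. *)
Lemma m_norm_leP x M : 0 <= M -> (m_norm phi p x <= M%:E)%E <->
  forall j m, mass_le p (block j m) x ((M / scaled d phi p j) `^ p).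
Proof.
move=> M0; have E0 j m : (0 <= \esum_(k in block j m) (normc (x k) `^ p)%:E)%E.
  by apply: esum_ge0 => k _; rewrite lee_fin powR_ge0.
have E j m : ((phi (side (- j%:Z)) / volume d (- j%:Z) `^ p^-1)%:E *
     (\esum_(k in [set k | (cube 0 k : set 'rV[R]_d) `<=` cube (- j%:Z) m])
        (normc (x k) `^ p)%:E) `^ p^-1)%E =
   ((scaled d phi p j)%:E * (\esum_(k in block j m) (normc (x k) `^ p)%:E) `^ p^-1)%E.
  congr (_%:E * _ `^ _)%E; last first.
    by congr esum; apply/seteqP; split=> k /cube_subsetP.
  rewrite /volume side_negn /scaled mulrC; congr (_ * _).
  by rewrite -exprM -powR_mulrn // -powRrM natrM powRN.
split=> [H j m|H].
  apply/esum_massP/root_leP; rewrite ?scaled_gt0 //.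
  by rewrite -E; apply: le_trans H; apply: ereal_sup_ubound; exists (j, m).
apply/ereal_supP => _ [[j m] _ <-] /=; rewrite E.
by apply/root_leP; rewrite ?scaled_gt0 //; apply/esum_massP.
Qed.

Lemma m_norm_coord x M k : phi 1 = 1 -> 0 <= M -> (m_norm phi p x <= M%:E)%E ->
  normc (x k) <= M.
Proof.
move=> phi1 M0 /m_norm_leP => /(_ M0 0%N k) H.
have := mass_le_coord p0 (block0_self k) H.
by rewrite scaled_div_powR // mul0n mul1r expr0 phi1 divr1 powRVK.
Qed.

End Growth.

Lemma lp_norm_leP p x M : 0 < p -> 0 <= M ->
  (lp_norm p x <= M%:E)%E <-> mass_le p setT x (M `^ p).
Proof.
move=> p0 M0; rewrite -esum_massP -[X in X `^ p](divr1 M) -root_leP // ?mul1e //.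
by apply: esum_ge0 => k _; rewrite lee_fin powR_ge0.
Qed.

End Blocks.

(** * Comparison of the norms *)

Section Comparisons.
Context {R : realType} {d : nat}.
Local Notation K := 'rV[int]_d.
Implicit Types (p M : R) (phi : R -> R) (x : K -> R[i]) (j : nat) (m k : K).

(** A linear bound between two norms follows from a bound between their balls:
    if [a] is finite, the radius [M] may decrease to [a]. *)
Lemma le_ereal_of_balls (a b : \bar R) (C : R) : (0 <= a)%E -> 0 < C ->
  (forall M, 0 < M -> (a <= M%:E)%E -> (b <= (C * M)%:E)%E) -> (b <= C%:E * a)%E.
Proof.
case: a => [r||] // r0 C0 H; last by rewrite gt0_muley ?lte_fin // leey.
apply/lee_addgt0Pr => e e0; rewrite lee_fin in r0.
apply: (le_trans (H (r + e / C) _ _)); first by rewrite ltr_wpDl // divr_gt0.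
  by rewrite lee_fin lerDl divr_ge0 // ltW.
by rewrite -EFinM -EFinD lee_fin mulrDr mulrCA divff ?mulr1 // gt_eqF.
Qed.

Lemma m_norm_ge0 phi p x : (forall j, 0 <= phi (2 ^+ j)) -> (0 <= m_norm phi p x)%E.
Proof.
move=> phi0; pose t := ((phi (side (- 0%:Z)) / volume d (- 0%:Z) `^ p^-1)%:E *
     (\esum_(k in [set k | (cube 0 k : set 'rV[R]_d) `<=` cube (- 0%:Z) (0 : K)])
        (normc (x k) `^ p)%:E) `^ p^-1)%E.
apply: (@le_trans _ _ t); last by apply: ereal_sup_ubound; exists (0%N, 0).
rewrite mule_ge0 ?poweR_ge0 // lee_fin side_negn mulr_ge0 ?phi0 //.
by rewrite invr_ge0 powR_ge0.
Qed.

(** The factors [scaled] are at most 1, so no cube exceeds the full sum. *)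
Lemma m_norm_le_lp phi p x M : 0 < p -> G_class d p phi -> phi 1 = 1 -> 0 <= M ->
  mass_le p setT x (M `^ p) -> (m_norm phi p x <= M%:E)%E.
Proof.
move=> p0 G phi1 M0 H; apply/(m_norm_leP p0 G) => // j m; apply: mass_leW H => //.
have s0 := scaled_gt0 G j.
apply: ler_powR2 => //; first exact: ltW.
by rewrite ler_pdivlMr // ler_piMr // (scaled_le1 G).
Qed.

(** Only cubes inside one of the [2^d] orthants of the lattice are nested
    dyadically, whence the constant [2^d]. *)
Lemma lp_le_m_norm phi p x M c : 0 < p -> G_class d p phi -> 0 < c ->
  (forall j, c <= scaled d phi p j) -> 0 <= M ->
  (m_norm phi p x <= M%:E)%E -> mass_le p setT x ((2 ^ d)%N%:R * (M / c) `^ p).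
Proof.
move=> p0 G c0 cs M0 /(m_norm_leP p0 G) => /(_ M0) H s us _.
have [j jP] : exists j, forall k i, k \in s -> (absz (k ord0 i) < 2 ^ j)%N.
  elim: s {us} => [|k s [j IH]]; first by exists 0%N.
  exists (\sum_i absz (k ord0 i) + j)%N => k' i; rewrite inE => /orP[/eqP->|ks].
    rewrite (bigD1 i) //= -addnA; apply: leq_ltn_trans (leq_addr _ _) _.
    exact: ltn_expl.
  apply: leq_trans (IH k' i ks) _; rewrite leq_exp2l //; exact: leq_addl.
(* The sign pattern of [k] selects its orthant; the cube of side [2 ^ j] next to
   the origin has index 0 or -1 in each direction. *)
pose sgn (k : K) := [ffun i => k ord0 i < 0].
rewrite /mass (partition_big sgn xpredT) //=.
apply: (@le_trans _ _ (\sum_(f : {ffun 'I_d -> bool}) (M / c) `^ p)); last first.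
  by rewrite sumr_const card_ffun card_bool card_ord -[leLHS]mulr_natl.
apply: ler_sum => f _; rewrite -big_filter.
apply: (@le_trans _ _ ((M / scaled d phi p j) `^ p)).
  apply: (H j (\row_i (if f i then -1 else 0))); first exact: filter_uniq.
  move=> k; rewrite mem_filter => /andP[/eqP kf ks] i; rewrite mxE.
  have := jP k i ks; have := congr1 (fun g : {ffun 'I_d -> bool} => g i) kf; rewrite ffunE.
  by case: (f i); lia.
apply: ler_powR2; rewrite ?(ltW p0) ?divr_ge0 ?(ltW (scaled_gt0 G _)) //.
by rewrite ler_wpM2l // lef_pV2 ?posrE // scaled_gt0.
Qed.

(** If [p2 <= p1], power means over a cube are compared. If [p1 < p2], the
    sum with exponent [p2] is interpolated between the supremum of the entries,
    which the unit cubes control, and the sum with exponent [p1]; this costs the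
    power [p1 / p2] of [phi1]. *)
Lemma m_norm_embed phi1 phi2 (p1 p2 : R) : 0 < p1 -> 0 < p2 ->
  G_class d p1 phi1 -> G_class d p2 phi2 -> phi1 1 = 1 ->
  (ereal_sup [set (phi2 (2 ^+ j) /
                  phi1 (2 ^+ j) `^ Num.min 1 (p1 / p2))%:E
                | j in [set: nat]] < +oo)%E ->
  exists2 C, 0 < C & forall x M, 0 < M ->
    (m_norm phi1 p1 x <= M%:E)%E -> (m_norm phi2 p2 x <= (C * M)%:E)%E.
Proof.
move=> p10 p20 G1 G2 phi11 hemb.
set rho := Num.min _ _ in hemb.
have [C C0 CP] : exists2 C, 0 < C & forall j, phi2 (2 ^+ j) <= C * phi1 (2 ^+ j) `^ rho.
  set S := ereal_sup _ in hemb; have SP j : ((phi2 (2 ^+ j) / phi1 (2 ^+ j) `^ rho)%:E <= S)%E.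
    by apply: ereal_sup_ubound; exists j.
  have S0 : (0 < S)%E.
    by apply: lt_le_trans (SP 0%N); rewrite lte_fin divr_gt0 ?powR_gt0 ?(G_gt0 G1) ?(G_gt0 G2).
  case: S hemb S0 SP => [r||] // _; rewrite ?lte_fin // => r0 SP; exists r => // j.
  by have := SP j; rewrite lee_fin ler_pdivrMr // powR_gt0 // (G_gt0 G1).
exists (2 `^ p2^-1 * C) => [|x M M0 H]; first by rewrite mulr_gt0 ?powR_gt0.
have CM0 : 0 <= 2 `^ p2^-1 * C * M by rewrite !mulr_ge0 ?powR_ge0 // ltW.
apply/(m_norm_leP p20 G2) => // j m; rewrite scaled_div_powR //.
have f10 := G_gt0 G1 j; have f20 := G_gt0 G2 j.
have CMf : 0 <= C * M / phi2 (2 ^+ j) by rewrite !mulr_ge0 ?invr_ge0 // ltW.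
have -> : (2 `^ p2^-1 * C * M / phi2 (2 ^+ j)) `^ p2 = 2 * (C * M / phi2 (2 ^+ j)) `^ p2.
  by rewrite -!mulrA (mulrA C) powRM ?powR_ge0 // powRKV.
have := (m_norm_leP p10 G1 _ (ltW M0)).1 H j m; rewrite scaled_div_powR ?ltW //.
have [l sl lP] := block_seq j m; rewrite -sl.
have [le|lt] := leP p2 p1.
  have D0 : 0 < M / phi1 (2 ^+ j) by rewrite divr_gt0.
  move=> /(mass_le_power_mean p20 le D0 lP); apply: mass_leW => //.
  rewrite mulrCA mulrA ler_wpM2l // ler_powR2 ?(ltW p20) ?(ltW D0) //.
  have := CP j; rewrite (_ : rho = 1) ?powRr1 ?(ltW f10) //; last first.
    by apply/min_idPl; rewrite ler_pdivlMr // mul1r.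
  move=> h; rewrite ler_pdivrMr // mulrAC ler_pdivlMr // (mulrC C) -mulrA.
  by rewrite ler_wpM2l // ltW.
have xM k : block j m k -> normc (x k) <= M.
  by move=> _; exact: (m_norm_coord p10 G1 k phi11 (ltW M0) H).
move=> /(mass_le_interp p10 (ltW lt) xM); apply: mass_leW => //.
rewrite mulrCA ler_wpM2l //.
apply: (@le_trans _ _ ((C * M / phi2 (2 ^+ j)) `^ p2)); last first.
  by rewrite ler_peMl ?powR_ge0 // ler1n.
have := CP j; rewrite (_ : rho = p1 / p2) => [h|]; last first.
  by apply/min_idPr; rewrite ler_pdivrMr // mul1r ltW.
rewrite [in leLHS]powR_div ?(ltW M0) ?(ltW f10) // mulrA -powRD ?subrK ?(gt_eqF M0) ?implybT //.
rewrite [leRHS]powR_div ?powRM ?mulr_ge0 ?(ltW C0) ?(ltW M0) ?(ltW f20) //.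
rewrite ler_pdivrMr ?powR_gt0 // mulrAC ler_pdivlMr ?powR_gt0 //.
rewrite (mulrC (C `^ p2)) -[leRHS]mulrA ler_wpM2l ?powR_ge0 //.
apply: le_trans (ler_powR2 (ltW p20) (ltW f20) h) _.
by rewrite powRM ?powR_ge0 ?(ltW C0) // -powRrM divfK ?gt_eqF.
Qed.

End Comparisons.

(** * Infinite-dimensional subspaces *)

Section Subspaces.
Context {R : realType} {K : choiceType}.
Local Notation U := (K -> R[i]).
Implicit Types (X Z : set U) (x z : U).

Lemma subspaceD X Z x y : subspace X Z -> Z x -> Z y -> Z (x + y).
Proof. by move=> [_ _ H] Zx Zy; rewrite -[x]scale1r; exact: H. Qed.

Lemma subspaceZ X Z (a : R[i]) x : subspace X Z -> Z x -> Z (a *: x).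
Proof. by move=> [_ Z0 H] Zx; rewrite -[_ *: _]addr0; exact: H. Qed.

Lemma infinite_dim_nonzero X Z : subspace X Z -> ~ finite_dimensional Z ->
  exists x k, Z x /\ x k != 0.
Proof.
move=> sZ; apply: contra_notP => H; exists 0%N, (fun=> 0); split=> [[]//|x Zx].
exists (fun=> 0); rewrite big_ord0; apply/funext => k; apply: contrapT => /eqP xk.
by apply: H; exists x, k.
Qed.

(** The kernel of one coordinate has codimension at most 1. *)
Lemma infinite_dim_coord0 X Z (k : K) : subspace X Z -> ~ finite_dimensional Z ->
  subspace X (Z `&` [set x | x k = 0]) /\ ~ finite_dimensional (Z `&` [set x | x k = 0]).
Proof.
move=> sZ; have [ZX Z0 ZP] := sZ => nfin; split.
  split=> [x [/ZX]//|//|a u v [Zu uk] [Zv vk]]; split; first exact: ZP.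
  by rewrite /= funD_apply funZ_apply uk vk mulr0 addr0.
apply: contra_not nfin => -[n [e [Ze eP]]].
have [[u Zu uk]|H] := pselect (exists2 u, Z u & u k != 0); last first.
  exists n, e; split=> [i|x Zx]; first exact: (Ze i).1.
  by apply: eP; split=> //=; apply: contrapT => /eqP xk; apply: H; exists x.
exists n.+1, (fun i => if unlift ord0 i is Some j then e j else u); split.
  by move=> i; case: unliftP => [j|] _ //; exact: (Ze j).1.
move=> x Zx; have [|a aP] := eP (- (x k / u k) *: u + x).
  split; first exact: ZP.
  by rewrite /= funD_apply funZ_apply mulNr divfK // addNr.
exists (fun i => if unlift ord0 i is Some j then a j else x k / u k).
rewrite big_ord_recl unlift_none.
under eq_bigr do rewrite liftK.
by rewrite -aP scaleNr addNKr.
Qed.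

Lemma infinite_dim_vanish X Z (F : seq K) : subspace X Z -> ~ finite_dimensional Z ->
  exists Z', [/\ subspace X Z', ~ finite_dimensional Z' & forall x, Z' x ->
                 Z x /\ forall k, k \in F -> x k = 0].
Proof.
move=> sZ nZ; elim: F => [|k F [Z' [sZ' nZ' H]]]; first by exists Z.
have [s1 n1] := infinite_dim_coord0 k sZ' nZ'; exists (Z' `&` [set x | x k = 0]).
split=> // x [/H[Zx xF] xk]; split=> // j; rewrite inE => /orP[/eqP->//|]; exact: xF.
Qed.

End Subspaces.

(** * The gliding hump in sequence spaces of summable powers *)

Section GlidingHump.
Context {R : realType} {K : countType} (p : R).
Hypothesis p0 : 0 < p.
Local Notation U := (K -> R[i]).
Implicit Types (x z : U) (Z : set U).

Definition lp_space : set U := [set x | exists c, mass_le p setT x c].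

(** Exact normalisation is replaced by mass between [1/2] and 1, which is
    witnessed by a finite list. *)
Lemma lp_normalize x s : lp_space x -> 0 < mass p x s ->
  exists a : R[i], mass_le p setT (a *: x) 1 /\
    exists2 t, uniq t & 2^-1 <= mass p (a *: x) t.
Proof.
move=> [c xc] xs; have [m xm mP] := mass_sup xc.
have [k ks xk] : exists2 k, k \in s & x k != 0.
  apply: contrapT => H; move: xs; rewrite /mass big1_seq ?ltxx // => k /= ks.
  case: (eqVneq (x k) 0) => [->|xk]; last by case: H; exists k.
  by rewrite Normc.normc0 powR0 // gt_eqF.
have m0 : 0 < m.
  apply: lt_le_trans (xm [:: k] isT _) => //.
  by rewrite mass_seq1 powR_gt0 // normc_gt0.
exists ((m^-1 `^ p^-1)%:C)%C.
have np : normc (((m^-1 `^ p^-1)%:C)%C : R[i]) `^ p = m^-1.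
  rewrite /= expr0n addr0 sqrtr_sqr ger0_norm ?powR_ge0 // powRKV // invr_ge0; exact: ltW.
split; first by have := mass_leZ (((m^-1 `^ p^-1)%:C)%C : R[i]) xm; rewrite np mulVf ?gt_eqF.
have [|t ut tP] := mP (m / 2); first by rewrite divr_gt0.
exists t => //; rewrite massZ np ler_pdivlMl //.
by apply: le_trans (ltW tP); lra.
Qed.

Section Hump.
Variables (S : nat -> R -> U -> Prop) (C : R).
Hypotheses (C0 : 0 < C)
  (S_mono : forall j a b x, 0 < a -> a <= b -> S j a x -> S j b x)
  (S_add : forall A delta, 0 < A -> 0 < delta -> exists2 e, 0 < e &
     forall j z x, S j A z -> S j e x -> S j (A + delta) (z + x))
  (S_bound : forall x, mass_le p setT x 1 -> forall j, S j C x)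
  (S_vanish : forall x, lp_space x -> forall e, 0 < e ->
     exists J, forall j, (J <= j)%N -> S j e x)
  (S_small : forall Z, subspace lp_space Z -> ~ finite_dimensional Z ->
     forall e J, 0 < e -> exists x,
       [/\ Z x, mass_le p setT x 1, exists2 s, uniq s & 2^-1 <= mass p x s &
           forall j, (j < J)%N -> S j e x]).

(** At least half of the mass of the new hump lies off the support so far; up to
    the factor [2 ^ p] and a tail of mass [eta], it adds to the mass. *)
Let eta : R := (2 `^ p)^-1 / 4.

Lemma eta_gt0 : 0 < eta.
Proof. by rewrite divr_gt0 // invr_gt0 powR_gt0. Qed.

(** One more hump is added to [z]: it is chosen small on the levels where [z]
    lives and off the coordinates that carry [z], so that the level bounds do
    not accumulate whereas the masses do. *)
Lemma hump_step Z n delta : subspace lp_space Z -> ~ finite_dimensional Z -> 0 < delta ->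
  exists z s, [/\ Z z, uniq s, n%:R * eta <= mass p z s & forall j, S j (C + delta) z].
Proof.
move=> sZ nZ; have e0 := eta_gt0.
elim: n delta => [|n IH] delta d0.
  exists 0, [::]; split=> //; first by case: sZ.
    by rewrite mul0r mass_ge0.
  move=> j; apply: (S_mono C0); first by rewrite lerDl ltW.
  apply: S_bound => s _ _; rewrite /mass big1 // => k _.
  by rewrite Normc.normc0 powR0 // gt_eqF.
have d20 : 0 < delta / 2 by rewrite divr_gt0.
have [z [s [Zz us zs Sz]]] := IH _ d20.
have lz : lp_space z by case: sZ => H _ _; exact: H.
have [c zc] := lz; have [F zF] := mass_tail zc e0.
have [e ep eP] := S_add (addr_gt0 C0 d20) d20.
have [J JP] := S_vanish lz ep.
pose s' := undup (s ++ F).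
have [Z' [sZ' nZ' Z'P]] := infinite_dim_vanish s' sZ nZ.
have [x [Z'x x1 [t ut xt] xJ]] := S_small sZ' nZ' J ep.
have [Zx xs'] := Z'P x Z'x.
pose t' := [seq k <- t | k \notin s'].
have xt' : mass p x t' = mass p x t.
  by apply: mass_filter => // k _; rewrite negbK; exact: xs'.
have ut' : uniq t' by exact: filter_uniq.
exists (z + x), (s' ++ t'); split.
- exact: subspaceD sZ _ _.
- rewrite cat_uniq undup_uniq ut' andbT; apply/hasPn => k.
  by rewrite mem_filter => /andP[].
- rewrite mass_cat (@eq_mass _ _ _ (z + x) z s'); last first.
    by move=> k ks; rewrite funD_apply xs' // addr0.
  rewrite -natr1 mulrDl mul1r lerD //.
    apply: le_trans zs _; apply: mass_subset; rewrite ?undup_uniq // => k ks.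
    by rewrite mem_undup mem_cat ks.
  have := massD_le (z + x) (- z) t' (ltW p0) (@ltr01 R).
  rewrite addrAC subrr add0r massN invr1 -mulrDr xt' => h.
  have {}h : 2^-1 <= 2 `^ p * (mass p (z + x) t' + mass p z t') by exact: le_trans h.
  have zt' : mass p z t' <= eta.
    apply: zF => // k; rewrite mem_filter mem_undup mem_cat negb_or => /andP[/andP[_ kF] _].
    by [].
  have : 2 * eta <= mass p (z + x) t' + mass p z t'.
    move: h; rewrite mulrC -ler_pdivrMr ?powR_gt0 // => h; apply: le_trans h.
    by rewrite /eta; lra.
  by lra.
- move=> j; have [Jj|jJ] := leqP J j.
    rewrite [z + x]addrC (_ : C + delta = C + delta / 2 + delta / 2); last by lra.
    apply: eP; last exact: JP.
    by apply: (S_mono C0) (S_bound x1 j); rewrite lerDl ltW.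
  rewrite (_ : C + delta = C + delta / 2 + delta / 2); last by lra.
  by apply: eP; [exact: Sz|exact: xJ].
Qed.

(** [S j a] stands for the ball of radius [a] at level [j]. If each fixed vector
    is small on late levels, and each infinite-dimensional subspace contains
    normalised vectors that are small on the early levels, then sums of
    successive humps have arbitrarily large mass, but stay in a fixed ball of
    all levels. *)
Lemma gliding_hump Z B : subspace lp_space Z -> ~ finite_dimensional Z ->
  exists z s, [/\ Z z, uniq s, B <= mass p z s & forall j, S j (C + 1) z].
Proof.
move=> sZ nZ; have := archi_boundP (_ : 0 <= `|B| / eta).
rewrite divr_ge0 ?(ltW eta_gt0) // => /(_ isT); set n := Num.Def.archi_bound _ => nP.
have [z [s [Zz us zs Sz]]] := hump_step n sZ nZ (@ltr01 R).
exists z, s; split=> //; apply: le_trans zs; apply: le_trans (ler_norm B) _.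
by rewrite -ler_pdivrMr ?eta_gt0 // ltW.
Qed.

End Hump.

(** The gliding hump with the single coordinates as levels: bounded entries
    and large mass give small entries after normalisation. *)
Lemma flat_vector Z e : subspace lp_space Z -> ~ finite_dimensional Z -> 0 < e ->
  exists x, [/\ Z x, mass_le p setT x 1, exists2 s, uniq s & 2^-1 <= mass p x s &
                forall k, normc (x k) <= e].
Proof.
move=> sZ nZ e0; pose S j (a : R) (x : U) := forall k, pickle k = j -> normc (x k) <= a.
have [||||||||z [s [Zz us zB Sz]]] := @gliding_hump S 1 _ _ _ _ _ _ Z ((2 / e) `^ p).
- by [].
- by move=> j a b x _ ab H k /H /le_trans; apply.
- move=> A delta A0 d0; exists delta => // j z x Hz Hx k kj.
  by apply: le_trans (normcD_le _ _) _; rewrite lerD ?Hz ?Hx.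
- move=> x x1 j k _; have := mass_le_coord p0 (I : setT k) x1.
  by rewrite powR1.
- move=> x [c xc] a a0; have [F xF] := mass_tail xc (powR_gt0 p a0).
  exists (\max_(k <- F) pickle k).+1 => j Jj k kj.
  have kF : k \notin F.
    apply/negP => kF; have := @leq_bigmax_seq _ F xpredT pickle k kF isT.
    by rewrite kj leqNgt Jj.
  have := mass_le_coord p0 (kF : [set k | k \notin F] k) xF.
  by rewrite powRVK // ltW.
- move=> Z' sZ' nZ' a J a0.
  have [Z'' [sZ'' nZ'' Z''P]] := infinite_dim_vanish (pmap unpickle (iota 0 J)) sZ' nZ'.
  have [x [k [Z''x xk]]] := infinite_dim_nonzero sZ'' nZ''.
  have [Z'x x0] := Z''P _ Z''x.
  have lx : lp_space x by case: sZ' => + _ _; apply.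
  have [|b [bx1 bx2]] := lp_normalize (s := [:: k]) lx.
    by rewrite mass_seq1 powR_gt0 // normc_gt0.
  exists (b *: x); split=> //; first exact: subspaceZ sZ' _.
  move=> j jJ k' k'j; rewrite funZ_apply x0 ?mulr0 ?Normc.normc0 ?ltW //.
  rewrite mem_pmap; apply/mapP; exists j; first by rewrite mem_iota.
  by rewrite -k'j pickleK.
- exact: sZ.
- exact: nZ.
have B0 : 0 < mass p z s.
  by apply: lt_le_trans zB; rewrite powR_gt0 // divr_gt0.
have lz : lp_space z by case: sZ => + _ _; apply.
have [a [az1 az2]] := lp_normalize lz B0.
exists (a *: z); split=> //; first exact: subspaceZ sZ _.
move=> k; rewrite funZ_apply Normc.normcM.
apply: le_trans (ler_wpM2l (normc_ge0 _) (Sz _ k erefl)) _.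
rewrite -ler_pdivlMr //; have : mass p (a *: z) s <= 1 by exact: az1.
rewrite massZ => h; apply: (@ler_powR_inv _ p); rewrite ?divr_ge0 ?(ltW e0) //.
rewrite -[e / _]invf_div -powR_inv1 ?divr_ge0 ?(ltW e0) // -powRrM mulN1r powRN.
rewrite -[leRHS]mul1r ler_pdivlMr ?powR_gt0 ?divr_gt0 //.
by apply: le_trans h; rewrite ler_wpM2l ?powR_ge0.
Qed.

End GlidingHump.

(** * Criteria for strict singularity *)

Section StrictSingularity.
Context {R : realType} {d : nat}.
Local Notation K := 'rV[int]_d.
Local Notation U := (K -> R[i]).
Implicit Types (p M : R) (phi : R -> R) (x : U) (j : nat) (m k : K).

Lemma G_ge0 phi p : G_class d p phi -> forall j, 0 <= phi (2 ^+ j).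
Proof. by move=> G j; rewrite ltW // (G_gt0 G). Qed.

Lemma m_norm_le_leZ phi p (a : R[i]) x M : 0 < p -> G_class d p phi -> 0 <= M ->
  (m_norm phi p x <= M%:E)%E -> (m_norm phi p (a *: x) <= (normc a * M)%:E)%E.
Proof.
move=> p0 G M0 /(m_norm_leP p0 G) => /(_ M0) H; apply/(m_norm_leP p0 G) => [|j m].
  by rewrite mulr_ge0 // normc_ge0.
have s0 := scaled_gt0 G j.
rewrite -mulrA powRM ?normc_ge0 ?divr_ge0 ?(ltW s0) //; exact: mass_leZ.
Qed.

Lemma m_normZ_le phi p (a : R[i]) x : 0 < p -> G_class d p phi -> a != 0 ->
  (m_norm phi p (a *: x) <= (normc a)%:E * m_norm phi p x)%E.
Proof.
move=> p0 G a0; apply: le_ereal_of_balls; rewrite ?normc_gt0 //.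
  exact: m_norm_ge0 (G_ge0 G).
by move=> M M0; apply: m_norm_le_leZ => //; exact: ltW.
Qed.

Lemma m_normZ phi p (a : R[i]) x : 0 < p -> G_class d p phi -> a != 0 ->
  m_norm phi p (a *: x) = ((normc a)%:E * m_norm phi p x)%E.
Proof.
move=> p0 G a0; apply/eqP; rewrite eq_le m_normZ_le //=.
have an := normc_gt0 a0.
rewrite -lee_pdivlMl // -{1}[x]scale1r -(mulVf a0) -scalerA.
by rewrite -Normc.normcV; apply: m_normZ_le; rewrite ?invr_eq0.
Qed.

Context {phi1 phi2 : R -> R} {p1 p2 : R}.
Hypotheses (p10 : 0 < p1) (p20 : 0 < p2)
  (G1 : G_class d p1 phi1) (G2 : G_class d p2 phi2) (phi11 : phi1 1 = 1).
Local Notation N1 := (@m_norm R d phi1 p1).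
Local Notation N2 := (@m_norm R d phi2 p2).

(** By homogeneity the vectors with [N1 x = 1] may be replaced by arbitrary
    ones; a lower bound for [N1 x] is all that has to be known. *)
Lemma strictly_singular_intro : bounded_operator N1 N2 (embedding R d) ->
  (forall Z, subspace (carrier N1) Z -> ~ finite_dimensional Z -> forall e, 0 < e ->
     exists x M, [/\ Z x, 0 < M, (M%:E < N1 x)%E & (N2 x <= (e * M)%:E)%E]) ->
  strictly_singular N1 N2 (embedding R d).
Proof.
move=> bd H; split=> // Z sZ nZ; apply/eqP; rewrite eq_le; apply/andP; split; last first.
  by apply: le_ereal_inf_tmp => _ [x _ <-]; exact: m_norm_ge0 (G_ge0 G2).
apply/lee_addgt0Pr => e e0; rewrite add0e.
have [x [M [Zx M0 Mx xM]]] := H Z sZ nZ e e0.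
have : (N1 x < +oo)%E by case: sZ => + _ _; apply.
case E: (N1 x) Mx => [r||] //; rewrite lte_fin => Mr _.
have r0 : 0 < r by exact: lt_trans Mr.
pose a : R[i] := ((r^-1)%:C)%C.
have na : normc a = r^-1.
  by rewrite /= expr0n addr0 sqrtr_sqr ger0_norm // invr_ge0 ltW.
have a0 : a != 0.
  by apply/eqP => a0; have := na; rewrite a0 Normc.normc0 => /esym/eqP; rewrite invr_eq0 gt_eqF.
apply: (@le_trans _ _ (N2 (a *: x))).
  apply: ereal_inf_lbound; exists (a *: x) => //; split; first exact: subspaceZ sZ _.
  by rewrite /= m_normZ // na E -EFinM mulVf // gt_eqF.
rewrite m_normZ // na lee_pdivrMl //; apply: le_trans xM _.
by rewrite -EFinM lee_fin mulrC ler_wpM2r // ltW.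
Qed.

Definition finitely_supported_on (pt : nat -> K) : set U :=
  [set x | exists N, forall k, x k != 0 -> exists2 n, (n < N)%N & k = pt n].

Lemma finitely_supported_on_list pt x : finitely_supported_on pt x ->
  exists l : seq K, exists2 M, (forall k, x k != 0 -> k \in l) & forall k, normc (x k) <= M.
Proof.
move=> [N H]; pose l := [seq pt n | n <- iota 0 N].
have xl k : x k != 0 -> k \in l.
  by move=> /H[n nN ->]; apply: map_f; rewrite mem_iota.
exists l, (\sum_(k <- l) normc (x k)) => // k.
have [->|xk] := eqVneq (x k) 0; first by rewrite Normc.normc0 sumr_ge0 // => *; exact: normc_ge0.
by rewrite (big_rem k (xl k xk)) /= lerDl sumr_ge0 // => *; exact: normc_ge0.
Qed.

Lemma finite_support_mass p x (l : seq K) M : 0 < p -> (forall k, x k != 0 -> k \in l) ->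
  (forall k, normc (x k) <= M) -> mass_le p setT x ((size l)%:R * M `^ p).
Proof. by move=> p0 xl xM; apply: mass_le_size => // k _; exact: xl. Qed.

Lemma finitely_supported_on_lp p pt x : 0 < p -> finitely_supported_on pt x -> lp_space p x.
Proof.
move=> p0 /finitely_supported_on_list[l [M xl xM]]; exists ((size l)%:R * M `^ p).
exact: finite_support_mass.
Qed.

Lemma finitely_supported_on_subspace X pt : finitely_supported_on pt `<=` X -> subspace X (finitely_supported_on pt).
Proof.
move=> sX; split=> //; first by exists 0%N => k; rewrite eqxx.
move=> a u v [N uN] [N' vN']; exists (maxn N N') => k; rewrite funD_apply funZ_apply => uv.
have [vk|/vN'[n nN ->]] := eqVneq (v k) 0; last by exists n; rewrite ?leq_max ?nN ?orbT.
have [uk|/uN[n nN ->]] := eqVneq (u k) 0; last by exists n; rewrite ?leq_max ?nN ?orbT.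
by move: uv; rewrite uk vk mulr0 addr0 eqxx.
Qed.

(** Finitely many vectors leave out some point [pt N], whose unit vector is
    therefore not in their span. *)
Lemma finitely_supported_on_infinite pt : injective pt -> ~ finite_dimensional (finitely_supported_on pt).
Proof.
move=> ptI [n [e [eS eP]]].
have [f fP] := choice eS.
pose N := (\sum_(i < n) f i)%N; pose x : U := fun k => if k == pt N then 1 else 0.
have [|a /(congr1 (fun y : U => y (pt N)))] := eP x.
  by exists N.+1 => k; rewrite /x; case: (eqVneq k (pt N)) => [-> _|_]; [exists N|rewrite eqxx].
rewrite {1}/x eqxx fct_sumE big1 => [/eqP|i _]; first by rewrite oner_eq0.
rewrite funZ_apply; have [->|/fP[n' n'f /ptI e']] := eqVneq (e i (pt N)) 0; first by rewrite mulr0.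
move: n'f; rewrite -e' ltnNge => /negP[]; rewrite /N (bigD1 i) //=; exact: leq_addr.
Qed.

(** A bound in the reverse direction on one infinite-dimensional subspace keeps
    the infimum away from 0. *)
Lemma not_strictly_singular pt C : injective pt -> 0 < C ->
  (forall x M, finitely_supported_on pt x -> 0 < M -> (N2 x <= M%:E)%E -> (N1 x <= (C * M)%:E)%E) ->
  ~ strictly_singular N1 N2 (embedding R d).
Proof.
move=> ptI C0 H [_ ss]; have sub : subspace (carrier N1) (finitely_supported_on pt).
  apply: finitely_supported_on_subspace => x /(finitely_supported_on_lp p10)[c xc].
  have c0 := mass_le_ge0 xc.
  apply: (@le_lt_trans _ _ (c `^ p1^-1)%:E); last exact: ltry.
  by apply: m_norm_le_lp; rewrite ?powR_ge0 ?powRKV.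
have /eqP := ss _ sub (finitely_supported_on_infinite ptI); apply/negP; rewrite gt_eqF //.
have CV : 0 < (C * 2)^-1 by rewrite invr_gt0 mulr_gt0.
apply: (@lt_le_trans _ _ ((C * 2)^-1)%:E); first by rewrite lte_fin.
apply: le_ereal_inf_tmp => _ [x [xS x1] <-]; rewrite leNgt; apply/negP => lt.
have := H x _ xS CV (ltW lt); rewrite x1 lee_fin invfM mulrA mulfV ?gt_eqF //.
by lra.
Qed.

Lemma scaled_small q phi e : 0 < e -> scaled d phi q @ \oo --> (0 : R) ->
  exists J, forall j, (J <= j)%N -> scaled d phi q j <= e.
Proof.
move=> e0 /cvgr0Pnorm_le /(_ e e0) [J _ JP]; exists J => j Jj.
by apply: le_trans (ler_norm _) _; exact: JP.
Qed.

End StrictSingularity.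

(** * Sparse sets that carry bounded sequences *)

Section Sparse.
Context {R : realType} {d : nat}.
Local Notation K := 'rV[int]_d.
Context {phi : R -> R} {p : R}.
Hypotheses (d0 : (0 < d)%N) (p0 : 0 < p) (G : G_class d p phi) (phi1 : phi 1 = 1)
  (phi0 : scaled d phi p @ \oo --> (0 : R)).

(** The weight of large cubes tends to 0, so the [n]-th exponent can be delayed
    until a cube that contains [n.+1] points is harmless. *)
Lemma sparse_exponents : exists b : nat -> nat,
  (forall n n', (n < n')%N -> (b n < b n')%N) /\
  forall n j, (b n <= j)%N -> n.+1%:R * scaled d phi p j `^ p <= 1.
Proof.
have H n : exists J, forall j, (J <= j)%N -> n.+1%:R * scaled d phi p j `^ p <= 1.
  have [|J JP] := scaled_small (e := n.+1%:R^-1 `^ p^-1) _ phi0.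
    by rewrite powR_gt0 // invr_gt0 ltr0Sn.
  exists J => j /JP h; rewrite mulrC -ler_pdivlMr ?ltr0Sn // mul1r.
  apply: le_trans (ler_powR2 (ltW p0) (ltW (scaled_gt0 G j)) h) _.
  by rewrite powRKV // invr_ge0.
have [B BP] := choice H.
pose b n := (\sum_(i < n.+1) (B i).+1)%N; exists b; split=> [|n j bj].
  have bS n : (b n < b n.+1)%N by rewrite /b [X in (_ < X)%N]big_ord_recr /= -addn1 leq_add.
  move=> n n'; exact: (homo_ltn (r := fun u v : nat => (u < v)%N) ltn_trans bS).
apply: BP; apply: leq_trans bj; rewrite /b big_ord_recr /=.
by apply: leq_trans (leqnSn _) (leq_addl _ _).
Qed.

(** A cube that contains both points is longer than their distance, which is at
    least [2 ^ (b - 1)]. *)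
Lemma block_two_powers (mu : int) (a b j : nat) : (a < b)%N ->
  ((2 ^ j)%N%:Z * mu <= (2 ^ a)%N%:Z)%R -> ((2 ^ b)%N%:Z < (2 ^ j)%N%:Z * (mu + 1))%R -> (b <= j)%N.
Proof.
case: b => // b ab; rewrite mulrDr mulr1 leqNgt => h1 h2; apply/negP => jb.
have e1 : (2 ^ a <= 2 ^ b)%N by rewrite leq_exp2l.
have e2 : (2 ^ j <= 2 ^ b)%N by rewrite leq_exp2l.
move: h2; rewrite expnS; move: (_ * mu) h1 => z; lia.
Qed.

(** The points [2 ^ b n] on the first axis. A cube contains either one of them,
    or only such with [b n <= j], of which there are few compared with its
    weight. On this set the Morrey norm is thus at most the supremum norm. *)
Lemma sparse_points : exists2 pt : nat -> K, injective pt &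
  forall x M, finitely_supported_on (R := R) pt x -> 0 < M -> (forall k, Normc.normc (x k) <= M) ->
    (m_norm phi p x <= M%:E)%E.
Proof.
have [b [bmono bP]] := sparse_exponents.
pose i0 := Ordinal d0.
have [pt ptE] : exists pt : nat -> K, forall n, pt n ord0 i0 = (2 ^ b n)%N%:Z.
  by exists (fun n => \row_i (2 ^ b n)%N%:Z) => n; rewrite mxE.
have bI : injective b.
  move=> n n' e; by have [/bmono|/bmono|] := ltngtP n n'; rewrite ?e ?ltnn.
exists pt.
  move=> n n' /rowP/(_ i0); rewrite !ptE => -[] /eqP; rewrite eqn_exp2l // => /eqP; exact: bI.
move=> x M [N xN] M0 xM; apply/(m_norm_leP p0 G); rewrite ?(ltW M0) // => j m.
have two n n' : block j m (pt n) -> block j m (pt n') -> (b n < b n')%N -> (b n' <= j)%N.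
  move=> /(_ i0) + /(_ i0); rewrite !ptE => /andP[h _] /andP[_ h'] lt.
  exact: block_two_powers lt h h'.
suff [l lP ls] : exists2 l : seq K, forall n, block j m (pt n) -> pt n \in l &
    (size l)%:R * scaled d phi p j `^ p <= 1.
  have xl k : block j m k -> x k != 0 -> k \in l.
    by move=> kB /xN[n _ e]; rewrite e; apply: lP; rewrite -e.
  apply: mass_leW (mass_le_size p0 xM xl) => //.
  rewrite powR_div ?(ltW M0) ?(ltW (scaled_gt0 G _)) //.
  rewrite ler_pdivlMr ?powR_gt0 ?scaled_gt0 //.
  by rewrite mulrAC ler_piMl // powR_ge0.
have [[n nB jn]|H] := pselect (exists2 n, block j m (pt n) & (j < b n)%N).
  exists [:: pt n] => [n' n'B|].
    suff -> : n' = n by rewrite mem_seq1.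
    apply: bI; apply/eqP; rewrite eqn_leq; apply/andP; split; rewrite leqNgt; apply/negP => lt.
      by have := two _ _ nB n'B lt; rewrite leqNgt (ltn_trans jn).
    by have := two _ _ n'B nB lt; rewrite leqNgt jn.
  have h := ler_powR2 (ltW p0) (ltW (scaled_gt0 G j)) (scaled_le1 G j phi1).
  by rewrite mul1r (le_trans h) // powR1.
have bj n : block j m (pt n) -> (b n <= j)%N.
  by move=> nB; rewrite leqNgt; apply/negP => h; apply: H; exists n.
have bn n : (n <= b n)%N by elim: n => // n /leq_ltn_trans; apply; exact: bmono.
have [[n0 n0B]|none] := pselect (exists n, block j m (pt n)); last first.
  by exists [::] => [n nB|]; [case: none; exists n|rewrite mul0r].
have ex : exists n, `[< block j m (pt n) >] by exists n0; apply/asboolP.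
have ub n : `[< block j m (pt n) >] -> (n <= j)%N.
  by move=> /asboolP/bj; exact: leq_trans.
have [n1 /asboolP n1B n1P] := ex_maxnP ex ub.
exists [seq pt n | n <- iota 0 n1.+1] => [n /asboolP nB|].
  by apply: map_f; rewrite mem_iota ltnS n1P.
by rewrite size_map size_iota; apply: bP; exact: bj.
Qed.

End Sparse.

(** * Morrey balls, level by level *)

Section MorreyHump.
Context {R : realType} {d : nat}.
Local Notation K := 'rV[int]_d.
Local Notation U := (K -> R[i]).
Context {phi : R -> R} {p : R}.
Hypotheses (p0 : 0 < p) (G : G_class d p phi).
Implicit Types (x z : U) (j : nat).

(** The part of the ball of radius [a] that is cut out by the cubes of side
    [2 ^ j]. *)
Definition level_ball j (a : R) x : Prop :=
  forall m, mass_le p (block j m) x ((a / scaled d phi p j) `^ p).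

Lemma level_ballP x a : 0 <= a -> (m_norm phi p x <= a%:E)%E <-> forall j, level_ball j a x.
Proof. by move=> a0; rewrite m_norm_leP //; split=> H j m; exact: H. Qed.

Lemma level_ball_mono j a b x : 0 < a -> a <= b -> level_ball j a x -> level_ball j b x.
Proof.
move=> a0 ab H m; apply: mass_leW (H m) => //; have s0 := scaled_gt0 G j.
by rewrite ler_powR2 ?(ltW p0) ?divr_ge0 ?(ltW a0) ?(ltW s0) // ler_pM2r // invr_gt0.
Qed.

(** A small perturbation enlarges the radius by little, uniformly in the
    level. *)
Lemma level_ball_add A delta : 0 < A -> 0 < delta -> exists2 e, 0 < e &
  forall j z x, level_ball j A z -> level_ball j e x -> level_ball j (A + delta) (z + x).
Proof.
move=> A0 d0.
(* [tau] is such that [(1 + tau) * A = A + delta / 2]; the gap [g] in the powers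
   that is left pays for [x]. *)
pose tau := delta / (2 * A); pose g := (A + delta) `^ p - (A + delta / 2) `^ p.
have t0 : 0 < tau by rewrite divr_gt0 // mulr_gt0.
have A2 : 0 < A + delta / 2 by rewrite addr_gt0 // divr_gt0.
have A1 : 0 < A + delta by rewrite addr_gt0.
have g0 : 0 < g.
  rewrite subr_gt0; apply: gt0_ltr_powR; rewrite ?nnegrE ?(ltW A2) ?(ltW A1) //.
  by rewrite ltrD2l gtr_pMr // invf_lt1 // ltr1n.
have T0 : 0 < 1 + tau^-1 by rewrite addr_gt0 // invr_gt0.
exists (g `^ p^-1 / (1 + tau^-1)) => [|j z x Hz Hx m].
  by rewrite divr_gt0 // powR_gt0.
have s0 := scaled_gt0 G j.
apply: mass_leW (mass_leD (ltW p0) t0 (Hz m) (Hx m)) => //.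
have e1 : (1 + tau) * A = A + delta / 2.
  by rewrite mulrDl mul1r /tau invfM mulrA divfK // gt_eqF.
have e2 (u : R) : (1 + tau^-1) * (u / (1 + tau^-1)) = u by rewrite mulrC divfK // gt_eqF.
rewrite -!powRM ?divr_ge0 ?powR_ge0 ?(ltW A0) ?(ltW s0) ?(ltW T0) // ?addr_ge0 ?(ltW t0) //.
rewrite !mulrA e1 -[(1 + tau^-1) * _ / _]mulrA e2.
rewrite !powR_div ?powR_ge0 ?(ltW A1) ?(ltW A2) ?(ltW s0) // powRKV ?(ltW g0) //.
by rewrite -mulrDl /g addrC subrK.
Qed.

(** On the levels below [J] the cubes have boundedly many points, so small
    entries make all their sums small. *)
Lemma level_ball_flat e J : 0 < e -> exists2 c, 0 < c &
  forall x, (forall k, normc (x k) <= c) -> forall j, (j < J)%N -> level_ball j e x.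
Proof.
move=> e0; have f0 := G_gt0 G J; exists (e / phi (2 ^+ J)); first by rewrite divr_gt0.
move=> x xc j jJ m; have [l sl lP] := block_seq j m.
rewrite (scaled_div_powR p0 G) ?(ltW e0) // -sl.
have xl k : block j m k -> x k != 0 -> k \in l by move=> kB _; exact: lP.
apply: mass_leW (mass_le_size p0 xc xl) => //; rewrite ler_wpM2l //.
have fj := G_gt0 G j.
rewrite ler_powR2 ?(ltW p0) ?divr_ge0 ?(ltW e0) ?(ltW f0) //.
by rewrite ler_pM2l // lef_pV2 ?posrE //; exact: (G_nondecreasing G (ltnW jJ)).
Qed.

(** A sequence of [l_q] is a finitely supported one up to a small error; for
    the former the vanishing of [scaled] suffices, the latter is small on all
    levels. *)
Lemma level_ball_vanish q C x : 0 < q -> 0 < C -> scaled d phi p @ \oo --> (0 : R) ->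
  (forall (y : U) M, 0 < M -> mass_le q setT y (M `^ q) -> (m_norm phi p y <= (C * M)%:E)%E) ->
  lp_space q x -> forall e, 0 < e -> exists J, forall j, (J <= j)%N -> level_ball j e x.
Proof.
move=> q0 C0 phi0 H [c xc] e e0.
have e2 : 0 < e / 2 by rewrite divr_gt0.
have [e1 e10 eP] := level_ball_add e2 e2.
have M0 : 0 < e1 / C by rewrite divr_gt0.
have [F xF] := mass_tail xc (powR_gt0 q M0).
pose y : U := fun k => if k \in F then x k else 0.
pose w : U := fun k => if k \in F then 0 else x k.
have xyw : x = y + w.
  by apply/funext => k; rewrite funD_apply /y /w; case: ifP; rewrite ?addr0 ?add0r.
have wb j : level_ball j e1 w.
  have Cn0 : C != 0 by rewrite gt_eqF.
  apply: (level_ballP w (ltW e10)).1; rewrite -[e1](divfK Cn0) mulrC.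
  apply: H => // s us _.
  have wF k : k \in s -> ~~ (k \notin F) -> w k = 0.
    by move=> _; rewrite negbK /w => ->.
  rewrite -(mass_filter q0 wF) (@eq_mass _ _ _ w x).
    by apply: xF => [|k]; rewrite ?filter_uniq // mem_filter => /andP[].
  by move=> k; rewrite mem_filter /w => /andP[/negbTE->].
pose Y := \sum_(k <- F) normc (x k).
have yY k : normc (y k) <= Y.
  rewrite /y; case: ifP => kF; last first.
    by rewrite Normc.normc0 sumr_ge0 // => *; exact: normc_ge0.
  by rewrite /Y (big_rem k kF) /= lerDl sumr_ge0 // => *; exact: normc_ge0.
have ym : mass_le p setT y ((size F)%:R * Y `^ p).
  by apply: finite_support_mass => // k; rewrite /y; case: ifP => //; rewrite eqxx.
set m := _ * _ in ym; have m0 : 0 <= m by exact: mass_le_ge0 ym.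
have m1 : 0 < m + 1 by rewrite ltr_wpDl.
have [|J JP] := scaled_small (e := (e / 2) / (m + 1) `^ p^-1) _ phi0.
  by rewrite divr_gt0 // powR_gt0.
exists J => j Jj; rewrite xyw [e]splitr; apply: eP => // b.
have s0 := scaled_gt0 G j; apply: mass_leW ym => //.
apply: (@le_trans _ _ (m + 1)); first by rewrite lerDl.
rewrite -[leLHS](@powRKV _ p) ?(ltW m1) //; apply: ler_powR2; rewrite ?powR_ge0 ?(ltW p0) //.
rewrite ler_pdivlMr // mulrC -ler_pdivlMr ?powR_gt0 //; exact: JP.
Qed.

End MorreyHump.

(** * The embedding *)

Section Main.
Context {R : realType} {d : nat}.
Local Notation K := 'rV[int]_d.
Local Notation U := (K -> R[i]).
Context {phi1 phi2 : R -> R} {p1 p2 : R}.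
Hypotheses (p10 : 0 < p1) (p20 : 0 < p2)
  (G1 : G_class d p1 phi1) (G2 : G_class d p2 phi2) (phi11 : phi1 1 = 1) (phi21 : phi2 1 = 1).
Local Notation N1 := (@m_norm R d phi1 p1).
Local Notation N2 := (@m_norm R d phi2 p2).

Lemma scaled_ge_lim phi p c : G_class d p phi -> scaled d phi p @ \oo --> (c : R) ->
  forall j, c <= scaled d phi p j.
Proof.
move=> G H j; have := @nonincreasing_cvgn_ge _ (scaled d phi p) (scaled_nonincreasing G).
by move=> /(_ (cvgP _ H) j); rewrite (cvg_lim _ H).
Qed.

Lemma scaled_cvg0_or_pos phi p : G_class d p phi ->
  scaled d phi p @ \oo --> (0 : R) \/ exists2 c : R, 0 < c & scaled d phi p @ \oo --> c.
Proof.
move=> G; have lb : has_lbound (range (scaled d phi p)).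
  by exists 0 => _ [j _ <-]; exact: ltW (scaled_gt0 G j).
have := nonincreasing_cvgn (scaled_nonincreasing G) lb; set l := inf _ => H.
have [l0|l0] := ltP 0 l; first by right; exists l.
left; suff -> : 0 = l by [].
apply/eqP; rewrite eq_le l0 andbT; apply: lb_le_inf; first by exists (scaled d phi p 0), 0%N.
by move=> _ [j _ <-]; exact: ltW (scaled_gt0 G j).
Qed.

Lemma carrier_leP (N : U -> \bar R) x : (0 <= N x)%E -> carrier N x <->
  exists2 M, 0 < M & (N x <= M%:E)%E.
Proof.
rewrite /carrier /=; case: (N x) => [r||] //.
  rewrite lee_fin => r0; split=> _; last exact: ltry.
  by exists (r + 1); [rewrite ltr_wpDl|rewrite lee_fin lerDl].
by move=> _; split=> // -[M _]; rewrite leye_eq.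
Qed.

Lemma lp_norm_ge0 p x : (0 <= @lp_norm R d p x)%E.
Proof. exact: poweR_ge0. Qed.

(** The root of the number of orthants, divided by the limit [c] of [scaled]:
    the norm of the inverse embedding is at most this. *)
Definition equiv_const n p c : R := (2 ^ n)%N%:R `^ p^-1 / c.

Lemma equiv_const_gt0 n p c : 0 < c -> 0 < equiv_const n p c.
Proof. by move=> c0; rewrite divr_gt0 // powR_gt0 // ltr0n expn_gt0. Qed.

Section Equivalence.
Context {phi : R -> R} {p c : R}.
Hypotheses (p0 : 0 < p) (G : G_class d p phi) (phi1E : phi 1 = 1)
  (c0 : 0 < c) (cP : scaled d phi p @ \oo --> (c : R)).

Lemma lp_le_equiv (x : U) M : 0 < M -> (m_norm phi p x <= M%:E)%E ->
  mass_le p setT x ((equiv_const d p c * M) `^ p).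
Proof.
move=> M0 H; have := lp_le_m_norm p0 G c0 (scaled_ge_lim G cP) (ltW M0) H.
rewrite /equiv_const -mulrA [_^-1 * M]mulrC [in X in _ -> X]powRM ?powR_ge0 ?divr_ge0 ?ltW //.
by rewrite powRKV.
Qed.

Lemma carrier_lp : carrier (@m_norm R d phi p) = lp_space p.
Proof.
apply/seteqP; split=> x.
  move=> /(carrier_leP (m_norm_ge0 p x (G_ge0 G))) [M M0 H]; exists ((equiv_const d p c * M) `^ p).
  exact: lp_le_equiv.
move=> [b xb]; have b0 := mass_le_ge0 xb; apply/(carrier_leP (m_norm_ge0 p x (G_ge0 G))).
have b1 : 0 < b + 1 by rewrite ltr_wpDl.
exists ((b + 1) `^ p^-1); first by rewrite powR_gt0.
apply: m_norm_le_lp; rewrite ?powR_ge0 // powRKV ?(ltW b1) //.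
by apply: mass_leW xb => //; rewrite lerDl.
Qed.

Lemma equivalent_lp : same_space_equivalent_norms (@m_norm R d phi p) (lp_norm p).
Proof.
have k0 := equiv_const_gt0 d p c0.
have up (x : U) : (lp_norm p x <= (equiv_const d p c)%:E * m_norm phi p x)%E.
  apply: le_ereal_of_balls => //; first exact: m_norm_ge0 (G_ge0 G).
  move=> M M0 H; apply/lp_norm_leP => //; first by rewrite mulr_ge0 // ltW.
  exact: lp_le_equiv.
have lo (x : U) : (m_norm phi p x <= 1%:E * lp_norm p x)%E.
  apply: le_ereal_of_balls => //; first exact: lp_norm_ge0.
  move=> M M0 /lp_norm_leP => /(_ p0 (ltW M0)) H; rewrite mul1r.
  by apply: m_norm_le_lp => //; exact: ltW.
split.
  apply/seteqP; split=> x; rewrite /carrier /= => H.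
    apply: le_lt_trans (up x) _; have := m_norm_ge0 p x (G_ge0 G).
    by case: (m_norm phi p x) H => [r||] // _ _; rewrite -EFinM ltry.
  by apply: le_lt_trans (lo x) _; rewrite mul1e.
exists 1, (equiv_const d p c); split=> // x _; split; last exact: up.
by have := lo x; rewrite !mul1e.
Qed.

End Equivalence.

(** The gliding hump for the Morrey levels. Early levels are dominated by the
    supremum of the entries, hence small on flat vectors; late levels vanish
    because [scaled] of [phi2] tends to 0. *)
Lemma strictly_singular_lp_source c1 C : 0 < C -> bounded_operator N1 N2 (embedding R d) ->
  0 < c1 -> scaled d phi1 p1 @ \oo --> (c1 : R) -> scaled d phi2 p2 @ \oo --> (0 : R) ->
  (forall (x : U) M, 0 < M -> (N1 x <= M%:E)%E -> (N2 x <= (C * M)%:E)%E) ->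
  strictly_singular N1 N2 (embedding R d).
Proof.
move=> C0 bd c10 c1P phi20 CP; apply: strictly_singular_intro => // Z.
rewrite (carrier_lp p10 G1 phi11 c10 c1P) => sZ nZ e e0.
have lpN2 (y : U) M : 0 < M -> mass_le p1 setT y (M `^ p1) -> (N2 y <= (C * M)%:E)%E.
  by move=> M0 yM; apply: CP => //; apply: m_norm_le_lp => //; exact: ltW.
pose k := equiv_const d p1 c1; pose M := (C + 1) / e.
have C1 : 0 < C + 1 by rewrite addr_gt0.
have M0 : 0 < M by rewrite divr_gt0.
have [||||||||z [s [Zz us zB Sz]]] :=
  @gliding_hump R K p1 p10 (@level_ball R d phi2 p2) C _ _ _ _ _ _ Z ((k * M) `^ p1 + 1).
- exact: C0.
- exact: level_ball_mono.
- exact: level_ball_add.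
- move=> x x1 j; apply: (level_ballP p20 G2 x (ltW C0)).1.
  by rewrite -[C]mulr1; apply: lpN2; rewrite ?powR1.
- move=> x lx a a0; exact (level_ball_vanish p20 G2 p10 C0 phi20 lpN2 lx a0).
- move=> Z' sZ' nZ' a J a0; have [b b0 bP] := level_ball_flat p20 G2 J a0.
  have [x [Z'x x1 xs xb]] := flat_vector p10 sZ' nZ' b0.
  by exists x; split=> // j jJ; exact: bP.
- exact: sZ.
- exact: nZ.
exists z, M; split=> //.
  rewrite ltNge; apply/negP => /(lp_le_equiv p10 G1 c10 c1P M0) zM.
  by have := le_trans zB (zM s us (fun _ _ => I)); rewrite gerDl ler10.
apply/(level_ballP p20 G2); first by rewrite mulr_ge0 // ltW.
by rewrite /M mulrC divfK ?gt_eqF.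
Qed.

(** Flat vectors: the sum with exponent [p2] is at most the power [p2 - p1] of
    the supremum. *)
Lemma strictly_singular_lp_lp c1 : bounded_operator N1 N2 (embedding R d) ->
  0 < c1 -> scaled d phi1 p1 @ \oo --> (c1 : R) -> p1 < p2 ->
  strictly_singular N1 N2 (embedding R d).
Proof.
move=> bd c10 c1P p12; apply: strictly_singular_intro => // Z.
rewrite (carrier_lp p10 G1 phi11 c10 c1P) => sZ nZ e e0.
have k0 := equiv_const_gt0 d p1 c10; set k := equiv_const d p1 c1 in k0.
(* [M] is such that [N1 x <= M] would leave [x] a mass of at most [1/4]. *)
pose M := 4^-1 `^ p1^-1 / k; have M0 : 0 < M by rewrite divr_gt0 // powR_gt0 // invr_gt0.
have q0 : 0 < p2 - p1 by rewrite subr_gt0.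
have eM : 0 < e * M by rewrite mulr_gt0.
(* The exponent turns the factor [b^(p2 - p1)], with [b] the bound for the
   entries, into [(e * M)^p2]. *)
have [x [Zx x1 [s us xs] xb]] := flat_vector p10 sZ nZ (powR_gt0 (p2 / (p2 - p1)) eM).
exists x, M; split=> //.
  rewrite ltNge; apply/negP => /(lp_le_equiv p10 G1 c10 c1P M0) zM.
  have := le_trans xs (zM s us (fun _ _ => I)).
  rewrite -/k /M mulrC divfK ?gt_eqF // powRKV ?invr_ge0 //; lra.
apply: m_norm_le_lp; rewrite ?(ltW eM) //.
have := mass_le_interp p10 (ltW p12) (fun k _ => xb k) x1.
by rewrite -powRrM divfK ?gt_eqF // mulr1.
Qed.

(** If the limit were 0, the first norm would be at most the supremum norm on
    a sparse set, while the second norm always dominates the supremum norm. *)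
Lemma strictly_singular_source : (0 < d)%N -> strictly_singular N1 N2 (embedding R d) ->
  exists2 c : R, 0 < c & scaled d phi1 p1 @ \oo --> c.
Proof.
move=> d0 ss; have [phi10|//] := scaled_cvg0_or_pos G1.
have [pt ptI ptP] := sparse_points d0 p10 G1 phi11 phi10.
suff H (x : U) M : finitely_supported_on pt x -> 0 < M -> (N2 x <= M%:E)%E -> (N1 x <= (1 * M)%:E)%E.
  by case: (not_strictly_singular p10 G1 phi11 ptI (@ltr01 R) H ss).
move=> xS M0 xM; rewrite mul1r; apply: ptP => // k.
exact: (m_norm_coord p20 G2 k phi21 (ltW M0) xM).
Qed.

(** Up to a constant, the second norm is that of [l_p2], which dominates that of [l_p1] and
    hence the first norm. *)
Lemma not_strictly_singular_lp_lp c2 : (0 < d)%N -> 0 < c2 ->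
  scaled d phi2 p2 @ \oo --> (c2 : R) -> p2 <= p1 ->
  ~ strictly_singular N1 N2 (embedding R d).
Proof.
move=> d0 c20 c2P p21.
pose pt n : K := \row_i n%:Z.
have ptI : injective pt by move=> n n' /rowP/(_ (Ordinal d0)); rewrite !mxE => -[].
have k0 := equiv_const_gt0 d p2 c20; set k := equiv_const d p2 c2 in k0.
apply: (not_strictly_singular p10 G1 phi11 ptI k0) => x M _ M0.
move=> /(lp_le_equiv p20 G2 c20 c2P M0); rewrite -/k => xM.
have kM : 0 < k * M by rewrite mulr_gt0.
apply: m_norm_le_lp; rewrite ?(ltW kM) //.
have xk k' : setT k' -> normc (x k') <= k * M.
  by move=> _; have := mass_le_coord p20 (I : setT k') xM; rewrite powRVK // ltW.
have := mass_le_interp p20 p21 xk xM.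
by rewrite -powRD ?subrK // (gt_eqF kM) implybT.
Qed.

End Main.

Theorem theorem5p7 (R : realType) (d : nat) (hd : (1 <= d)%N)
    (p1 p2 : R) (hp1 : 0 < p1) (hp2 : 0 < p2)
    (phi1 phi2 : R -> R)
    (hphi1 : G_class d p1 phi1) (hphi2 : G_class d p2 phi2)
    (hphi11 : phi1 1 = 1) (hphi21 : phi2 1 = 1)
    (hsup1 : unbounded_on_D phi1) (hsup2 : unbounded_on_D phi2)
    (hemb : (ereal_sup [set (phi2 (2 ^+ j) /
                  phi1 (2 ^+ j) `^ Num.min 1 (p1 / p2))%:E
                | j in [set: nat]] < +oo)%E) :
  let id_ss := strictly_singular (m_norm phi1 p1) (m_norm phi2 p2)
                 (embedding R d) in
  [/\ bounded_operator (m_norm phi1 p1) (m_norm phi2 p2) (embedding R d),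
      scaled d phi2 p2 @ \oo --> (0 : R) ->
        ((exists2 c : R, 0 < c & scaled d phi1 p1 @ \oo --> c) ->
         (p1 = p2 /\ p2%:E = r_index d phi2 -> 1 <= p1 /\ 1 <= p2) ->
         id_ss) /\
        (id_ss ->
         (exists2 c : R, 0 < c & scaled d phi1 p1 @ \oo --> c) /\
         same_space_equivalent_norms (@m_norm R d phi1 p1) (lp_norm p1)) &
      (exists2 c : R, 0 < c & scaled d phi2 p2 @ \oo --> c) ->
        same_space_equivalent_norms (@m_norm R d phi2 p2) (lp_norm p2) /\
        (id_ss <->
         (exists2 c' : R, 0 < c' & scaled d phi1 p1 @ \oo --> c') /\ p1 < p2)].
Proof.
move=> id_ss.
have [C C0 CP] := m_norm_embed hp1 hp2 hphi1 hphi2 hphi11 hemb.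
have bd : bounded_operator (m_norm phi1 p1) (m_norm phi2 p2) (embedding R d).
  exists C => x _; apply: le_ereal_of_balls => //; first exact: m_norm_ge0 (G_ge0 hphi1).
  by move=> M; exact: CP.
have source := strictly_singular_source hp1 hp2 hphi1 hphi2 hphi11 hphi21 hd.
split=> // [phi20|[c2 c20 c2P]].
  split=> [[c c0 cP] _|ss].
    exact: (strictly_singular_lp_source hp1 hp2 hphi1 hphi2 hphi11 C0 bd c0 cP phi20 CP).
  have [c c0 cP] := source ss; split; first by exists c.
  exact: (equivalent_lp hp1 hphi1 hphi11 c0 cP).
split; first exact: (equivalent_lp hp2 hphi2 hphi21 c20 c2P).
split=> [ss|[[c c0 cP] p12]]; last first.
  exact: (strictly_singular_lp_lp hp1 hp2 hphi1 hphi2 hphi11 hphi21 bd c0 cP p12).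
split; first exact: source.
rewrite ltNge; apply/negP => p21.
exact: (not_strictly_singular_lp_lp hp1 hp2 hphi1 hphi2 hphi11 hd c20 c2P p21 ss).
Qed.
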